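(* Let $\mathrm{W}$ denote Wythoff Nim and $\mathrm{W}^\star$ the invariant subtraction game whose moves are the non-zero $P$-positions of $\mathrm{W}$. For all $n\in\mathbb{N}$, provided both coordinates are positive, the following positions (and their symmetric counterparts, obtained by exchanging the two coordinates) belong to $\mathcal{P}(\mathrm{W}^\star)$: (i) $(F_{2n}-1,\,F_{2n}-1)$; (ii) $(F_{2n-1},\,F_{2n}-1)$; (iii) $(F_{2n-1},\,F_{2n}-4)$; (iv) $(F_{2n-1},\,F_{2n}-9)$; (v) $(F_{2n-1}+1,\,F_{2n}-1)$; (vi) $(F_{2n-1}+3,\,F_{2n}-1)$; (vii) $(F_{2n-1}+4,\,F_{2n}-1)$; (viii) $(F_{2n-1}+6,\,F_{2n}-1)$.
   Context: $\mathbb{N}=\{1,2,3,\dots\}$, $\mathbb{N}_0=\{0,1,2,\dots\}$. Fibonacci numbers: $F_0=F_1=1$, $F_n=F_{n-1}+F_{n-2}$ for $n\ge 2$. An invariant subtraction game $G$ on $\mathbb{N}_0\times\mathbb{N}_0$ is given by a set of moves $\mathcal{M}(G)\subseteq(\mathbb{N}_0\times\mathbb{N}_0)\setminus\{(0,0)\}$; from position $(x,y)$ the options are all $(x-i,y-j)$ with $(i,j)\in\mathcal{M}(G)$, $i\le x$, $j\le y$. Two players alternate and a player who cannot move loses. A position is $P$ if all its options are $N$ (in particular if it has no options) and is $N$ if it has at least one $P$ option; $\mathcal{P}(G)$ is the set of $P$-positions. The game $G^\star$ is defined by $\mathcal{M}(G^\star)=\mathcal{P}(G)\setminus\{(0,0)\}$.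 Wythoff Nim $\mathrm{W}$ has moves $(0,x),(x,0),(x,x)$ for all $x\in\mathbb{N}$. It is well known that $\mathcal{P}(\mathrm{W})$ consists of all $(A_n,B_n)$ and $(B_n,A_n)$, $n\in\mathbb{N}_0$, where $A_n=\lfloor \phi n\rfloor$, $B_n=A_n+n$, $\phi=\frac{1+\sqrt5}{2}$.
   Formalization: The listed pairs are taken only when the first coordinate is at most the second; otherwise the claim fails, e.g. (v) at n=1 gives (2,1), itself a move to (0,0). Exactly ten false instances with n ≤ 3 are excluded. *)

(* Defs.v *)
From mathcomp Require Import all_boot.
Set Implicit Arguments.
Unset Strict Implicit.
Unset Printing Implicit Defensive.

(* Indexing pitfall: [fib 0 = fib 1 = 1], not the more common F_0 = 0. *)
Fixpoint fib (n : nat) : nat :=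
  match n with
  | 0 => 1
  | k.+1 => match k with
            | 0 => 1
            | l.+1 => fib k + fib l
            end
  end.

Record game : Type := Game {
  move : nat -> nat -> Prop;
  move_nonzero : ~ move 0 0
}.

Definition is_option (G : game) (p q : nat * nat) : Prop :=
  exists i j : nat,
    [/\ move G i j, i <= p.1, j <= p.2 & q = (p.1 - i, p.2 - j)].

(* Since (0,0) is never a move, play always terminates, so every position is
   exactly one of P and N, and this least solution of the defining clauses is
   the only one. *)
Inductive Ppos (G : game) (p : nat * nat) : Prop :=
  | Ppos_intro of (forall q, is_option G p q -> Npos G q)
with Npos (G : game) (p : nat * nat) : Prop :=
  | Npos_intro q of is_option G p q & Ppos G q.

Definition star_move (G : game) (i j : nat) : Prop :=
  Ppos G (i, j) /\ (i, j) <> (0, 0).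

Lemma star_move_nonzero (G : game) : ~ star_move G 0 0.
Proof. by case=> _; apply. Qed.

Definition star (G : game) : game := Game (@star_move_nonzero G).

Definition wythoff_move (i j : nat) : Prop :=
  exists2 x : nat, 0 < x & [\/ (i, j) = (0, x), (i, j) = (x, 0) | (i, j) = (x, x)].

Lemma wythoff_move_nonzero : ~ wythoff_move 0 0.
Proof. by case=> x x_gt0 [] [] // x0; rewrite -x0 in x_gt0. Qed.

Definition wythoff : game := Game wythoff_move_nonzero.

(* Main.v *)
Require Import Defs.
From mathcomp Require Import all_boot.
From mathcomp Require Import zify.

Set Implicit Arguments.
Unset Strict Implicit.
Unset Printing Implicit Defensive.

(** Write w = abaababa... for the Fibonacci word, indexed from 1. The positions
    of the letter a are the lower Wythoff numbers A_1 < A_2 < ..., those of b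
    are the B_n = A_n + n, and n is the number of letters a up to A_n. So with
    c(x) the number of letters a among the first x letters and h(x) = x + c(x),
    the moves of the dual game are the pairs (x, h(x)) with w_x = a and their
    transposes; no irrational number is needed.

    In the dual game every position on an axis is terminal, hence P. A position
    (u, v) with 0 < u <= v is therefore N as soon as some move leads to an axis,
    and this happens unless w_u = w_v = a and v < h(u) (Nstar_off, Nstar_far).

    Put F = F_{2n-1}, G = F_{2n} and m = F_{2n-2} = c(F). The prefixes of w of
    length F - 2 and G - 2 are palindromes (fw_pal): reflection in F - 1 or in
    G - 1 preserves letters, while x -> h(x) exchanges them (fw_fh). So if one
    subtracts a move (x, h(x)) from a position whose second coordinate is G - 1,
    the second coordinate becomes a b, and the new position is N; by
    symmetry this already shows that (G - 1, G - 1) is P (Pstar_diag). If one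
    subtracts (h(x), x) instead, the new position (u, v) satisfies v >= h(u)
    unless c(x) is smaller than the offset of the given position
    from (F, G - 1) (Pstar_row). For the second coordinates G - 4 and G - 9 the
    palindromes are combined with the fact that if x and x + 1 both carry the
    letter a, then h(x + 1) + 3 and h(x + 1) + 8 carry the letter b (fw_aa_fh,
    Pstar_col).

    There remain finitely many options, the same for all n. Some of them can
    still reach an axis; for the others, one replies with the move
    (F - 1 - i, G - 1 - h(i)) for a suitable i in {4, 9, 12} (Nstar_reply), which
    lands on one of the fixed P-positions (1,1), (3,3), (3,4), (6,6), (8,9),
    (11,11), (11,12), (14,14), and these are checked by computation
    (smallP_Ppos). *)

(** * The Fibonacci word *)

(** Finite Fibonacci words, of length [fib k]; [true] stands for the letter a and
    [false] for b. From index 1 on, each is a prefix of the next. *)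
Fixpoint fibword (k : nat) : seq bool :=
  match k with
  | 0 => [:: false]
  | k1.+1 => match k1 with
             | 0 => [:: true]
             | k2.+1 => fibword k1 ++ fibword k2
             end
  end.

(** The [x]-th letter of the infinite Fibonacci word, positions starting at 1,
    with the default value [fw 0 = false]. Thus [fw x] says that [x] is a lower
    Wythoff number. *)
Definition fw (x : nat) : bool := nth false (false :: fibword x.+1) x.

(** The number of letters a at positions [1], ..., [x]. *)
Fixpoint fcount (x : nat) : nat := if x is y.+1 then fcount y + fw x else 0.

(** The length of the image of the prefix of length [x] under the substitution
    a -> ab, b -> a. On lower Wythoff numbers it is the map A_n -> B_n. *)
Definition fh (x : nat) : nat := x + fcount x.

Arguments fibword : simpl never.

Lemma fibS k : fib k.+2 = fib k.+1 + fib k. Proof. by []. Qed.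

Lemma fib_gt0 k : 0 < fib k.
Proof.
suff: 0 < fib k /\ 0 < fib k.+1 by case.
by elim: k => // k [IH1 IH2]; rewrite fibS; split=> //; lia.
Qed.

Lemma leq_fib j k : j <= k -> fib j <= fib k.
Proof.
move=> /subnKC <-; elim: (k - j) => [|d IH]; first by rewrite addn0.
apply: leq_trans IH _; rewrite addnS; case: (j + d) => [//|e].
by rewrite fibS leq_addr.
Qed.

Lemma fib_ge k : k <= fib k.
Proof.
suff: k <= fib k /\ k.+1 <= fib k.+1 by case.
elim: k => // k [IH1 IH2]; rewrite fibS; split=> //.
by move: (fib_gt0 k); lia.
Qed.

Lemma fibwordS k : fibword k.+2 = fibword k.+1 ++ fibword k. Proof. by []. Qed.

Lemma size_fibword k : size (fibword k) = fib k.
Proof.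
suff: size (fibword k) = fib k /\ size (fibword k.+1) = fib k.+1 by case.
elim: k => // k [IH1 IH2]; split=> //.
by rewrite fibwordS size_cat IH1 IH2.
Qed.

Lemma nth_fibword j k x : j <= k -> x <= fib j.+1 ->
  nth false (false :: fibword k.+1) x = nth false (false :: fibword j.+1) x.
Proof.
move=> /subnKC <-; elim: (k - j) => [|d IH] Hx; first by rewrite addn0.
rewrite -(IH Hx) addnS fibwordS -cat_cons nth_cat /= size_fibword ltnS.
by rewrite (leq_trans Hx) // leq_fib //; lia.
Qed.

Lemma fwE j x : x <= fib j.+1 -> fw x = nth false (false :: fibword j.+1) x.
Proof.
move=> Hx; rewrite /fw; case: (leqP j x) => Hjx; first exact: nth_fibword.
rewrite -(nth_fibword (ltnW Hjx)) //.
exact: leq_trans (leqnSn x) (fib_ge _).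
Qed.

Lemma fw_shift k i : 0 < i -> i <= fib k.+1 -> fw (fib k.+2 + i) = fw i.
Proof.
case: i => // i _ Hi; rewrite (@fwE k.+2) ?(@fwE k) //; last first.
  by rewrite fibS leq_add2l.
by rewrite fibwordS addnS /= nth_cat size_fibword ltnNge leq_addr /= addKn.
Qed.

(** Induction along the factorisation of the word of index k+3 into those of
    indices k+2 and k+1, the second of which is a prefix of the first. *)
Lemma fib_ind (P : nat -> Prop) : P 1 -> P 2 ->
  (forall k i, 0 < i -> i <= fib k.+1 -> P i -> P (fib k.+2 + i)) ->
  forall x, 0 < x -> P x.
Proof.
move=> P1 P2 PS; elim/ltn_ind => x IH x_gt0.
have [xle2|xgt2] := leqP x 2; first by move: x x_gt0 xle2 {IH} => [|[|[|]]].
suff [k [k1 k2]] : exists k, fib k.+2 < x /\ x <= fib k.+3.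
  rewrite (fibS k.+1) in k2; have := fib_gt0 k.+2 => k0.
  by rewrite -(subnKC (ltnW k1)); apply: PS; last apply: IH; lia.
have ex : exists k, x <= fib k by exists x; exact: fib_ge.
case: (ex_minnP ex) => -[|[|[|k]]] Hk Hmin; try by move: Hk; rewrite /=; lia.
by exists k; split=> //; rewrite ltnNge; apply/negP => /Hmin; lia.
Qed.

Lemma fw_gt0 x : fw x -> 0 < x. Proof. by case: x. Qed.

Lemma fcountS x : fcount x.+1 = fcount x + fw x.+1. Proof. by []. Qed.

Lemma fcount_shift_aux k i : fcount (fib k.+2) = fib k.+1 -> i <= fib k.+1 ->
  fcount (fib k.+2 + i) = fib k.+1 + fcount i.
Proof.
move=> E; elim: i => [|i IH] Hi; first by rewrite !addn0.
by rewrite addnS !fcountS IH ?(ltnW Hi) // -addnS fw_shift // addnA.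
Qed.

Lemma fcount_fib k : fcount (fib k.+1) = fib k.
Proof.
suff: fcount (fib k.+1) = fib k /\ fcount (fib k.+2) = fib k.+1 by case.
elim: k => // k [IH1 IH2]; split=> //.
by rewrite (fibS k.+1) fcount_shift_aux // IH1.
Qed.

Lemma fcount_shift k i : i <= fib k.+1 ->
  fcount (fib k.+2 + i) = fib k.+1 + fcount i.
Proof. by apply: fcount_shift_aux; exact: fcount_fib. Qed.

Lemma fh_fib k : fh (fib k.+1) = fib k.+2.
Proof. by rewrite /fh fcount_fib. Qed.

Lemma fh_shift k i : i <= fib k.+1 -> fh (fib k.+2 + i) = fib k.+3 + fh i.
Proof. by move=> Hi; rewrite /fh fcount_shift // (fibS k.+1); lia. Qed.

Lemma leq_fcount x y : x <= y -> fcount x <= fcount y.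
Proof.
by move=> /subnKC <-; elim: (y - x) => [|d IH]; rewrite ?addn0 // addnS fcountS; lia.
Qed.

Lemma leq_fh x y : x <= y -> fh x <= fh y.
Proof. by move=> Hxy; rewrite leq_add ?leq_fcount. Qed.

Lemma fhS x : fh x.+1 = (fh x).+1 + fw x.+1.
Proof. by rewrite /fh fcountS; lia. Qed.

Lemma ltn_fh x y : x < y -> fh x < fh y.
Proof. by move=> /leq_fh; apply: leq_trans; rewrite fhS; lia. Qed.

Lemma fh_inj : injective fh.
Proof.
move=> x y E; case: (ltngtP x y) => // /ltn_fh; rewrite E ltnn //.
Qed.

Lemma fcount_lt x y : x < y -> fw y -> fcount x < fcount y.
Proof.
by case: y => // y Hxy wy; have := @leq_fcount x y Hxy; rewrite fcountS wy; lia.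
Qed.

Lemma fcount_inj x y : fw x -> fw y -> fcount x = fcount y -> x = y.
Proof.
move=> wx wy E; case: (ltngtP x y) => // /fcount_lt; rewrite E ltnn.
  by move=> /(_ wy).
by move=> /(_ wx).
Qed.

Lemma fcount_gt0 x : fw x -> 0 < fcount x.
Proof. by move=> wx; apply: (@fcount_lt 0) => //; exact: fw_gt0. Qed.

Lemma fh_gt x : fw x -> x < fh x.
Proof. by move=> /fcount_gt0; rewrite /fh; lia. Qed.

(** The image of a prefix under the substitution ends in b if the prefix ends in
    a, and in a otherwise. *)
Lemma fw_fh x : 0 < x -> fw (fh x) = ~~ fw x.
Proof.
move: x; apply: fib_ind => // k i i_gt0 Hi IH.
rewrite fh_shift // !fw_shift //; first by rewrite /fh; lia.
by rewrite -fh_fib leq_fh.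
Qed.

(** With [fw_fh]: the lower Wythoff numbers and their images under [fh]
    partition the positive integers. *)
Lemma fh_onto z : 0 < z -> ~~ fw z -> exists2 x, fw x & z = fh x.
Proof.
move: z; apply: fib_ind => //; first by exists 1.
move=> k i i_gt0 Hi IH; rewrite fw_shift // => /IH [x wx E].
case: k Hi => [|k] Hi; first by move: wx; rewrite E in Hi; move: Hi; case: x {E} => [|[|x]].
have Hx : x <= fib k.+1.
  rewrite leqNgt; apply/negP => /ltn_fh; rewrite fh_fib -E; lia.
by exists (fib k.+2 + x); [rewrite fw_shift // fw_gt0|rewrite fh_shift // E].
Qed.

Lemma fcount_onto x d : 0 < d -> d <= fcount x ->
  exists2 y, fw y /\ y <= x & fcount y = d.
Proof.
move=> d_gt0; elim: x => [|x IH]; first by rewrite /=; lia.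
rewrite fcountS => Hd; case: (leqP d (fcount x)) => [/IH [y [wy yx] E]|Hd2].
  by exists y => //; split=> //; lia.
exists x.+1; last by rewrite fcountS; move: Hd Hd2; case: (fw _) => /=; lia.
by split=> //; move: Hd Hd2; case: (fw _) => //=; lia.
Qed.

Lemma fw_fib k : fw (fib k.+1) = ~~ odd k.
Proof.
suff: fw (fib k.+1) = ~~ odd k /\ fw (fib k.+2) = odd k by case.
elim: k => // k [IH1 IH2]; rewrite IH2 oddS negbK; split=> //.
by rewrite fibS fw_shift ?fib_gt0 // leqnn.
Qed.

Lemma fw_fib_pred k : fw (fib k.+3).-1 = odd k.
Proof.
suff: fw (fib k.+3).-1 = odd k /\ fw (fib k.+4).-1 = ~~ odd k by case.
elim: k => // k [IH1 IH2]; rewrite IH2 oddS negbK; split=> //.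
rewrite -IH1.
have H : 1 < fib k.+3 by rewrite fibS; move: (fib_gt0 k.+1) (fib_gt0 k.+2); lia.
have -> : (fib k.+4.+1).-1 = fib k.+4 + (fib k.+3).-1 by rewrite (fibS k.+3); lia.
by rewrite fw_shift //; lia.
Qed.

(** The prefix of length [fib k.+1 - 2] is a palindrome. *)
Lemma fw_pal k i : 0 < i -> i + 1 < fib k.+1 -> fw (fib k.+1 - 1 - i) = fw i.
Proof.
elim/ltn_ind: k i => -[|[|k]] IH i i_gt0; rewrite ?[fib 1]/= ?[fib 2]/=; try by lia.
rewrite (fibS k.+1) => Hi.
have pal_small j : 0 < j -> j + 1 < fib k.+1 ->
    fw (fib k.+2 + fib k.+1 - 1 - j) = fw j.
  move=> j_gt0 Hj.
  have -> : fib k.+2 + fib k.+1 - 1 - j = fib k.+2 + (fib k.+1 - 1 - j) by lia.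
  by rewrite fw_shift ?IH //; lia.
(* These two equalities settle the positions around the junction of the two
   factors, where neither induction hypothesis applies. *)
have [mid1 mid2] : fw (fib k.+2) = fw (fib k.+1 - 1) /\
                   fw (fib k.+1) = fw (fib k.+2 - 1).
  case: k {IH pal_small Hi} => [|[|k]] //.
  by rewrite !subn1 !fw_fib !fw_fib_pred !oddS !negbK.
case: (ltnP (i + 1) (fib k.+1)) => H1; first exact: pal_small.
case: (ltnP (fib k.+2) i) => H2.
  (* The reflection of i falls under pal_small. *)
  by rewrite -[LHS]pal_small ?subKn //; lia.
have [Ei|Ni] := eqVneq (i + 1) (fib k.+1).
  have -> : fib k.+2 + fib k.+1 - 1 - i = fib k.+2 by lia.
  by have -> : i = fib k.+1 - 1 by lia.
have [Ei'|Ni'] := eqVneq i (fib k.+1).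
  have -> : fib k.+2 + fib k.+1 - 1 - i = fib k.+2 - 1 by lia.
  by rewrite Ei'.
have [Ej|Nj] := eqVneq i (fib k.+2).
  have -> : fib k.+2 + fib k.+1 - 1 - i = fib k.+1 - 1 by lia.
  by rewrite Ej.
have [Ej'|Nj'] := eqVneq (i + 1) (fib k.+2).
  have -> : fib k.+2 + fib k.+1 - 1 - i = fib k.+1 by lia.
  by have -> : i = fib k.+2 - 1 by lia.
case: k IH Hi pal_small mid1 mid2 H1 H2 Ni Ni' Nj Nj' => [|k] IH Hi pal_small _ _ H1 H2 Ni Ni' Nj Nj'.
  by move: Hi H1 H2 Ni Ni' Nj Nj'; rewrite /=; lia.
have F3 := fibS k.+1; have F4 := fibS k.+2.
have [j Ei Hj] : exists2 j, i = fib k.+2 + j & 0 < j /\ j + 1 < fib k.+1.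
  by exists (i - fib k.+2); lia.
have -> : fib k.+3 + fib k.+2 - 1 - i = fib k.+3 - 1 - j by lia.
by rewrite Ei (@fw_shift k j) ?(IH k.+2) //; case: Hj; lia.
Qed.

(** The word has no factor bb. *)
Lemma fw_no_bb z : 0 < z -> ~~ fw z -> fw z.+1.
Proof.
move=> z_gt0 /(fh_onto z_gt0) [x wx Ez]; apply/negPn/negP => /fh_onto [] // y wy Ey.
case: (ltngtP x y) => Hxy; last by move: Ey; rewrite -Hxy; lia.
- case: y wy Ey Hxy => // y wy; rewrite fhS wy => Ey Hxy.
  by have := @leq_fh x y Hxy; lia.
- by have := ltn_fh Hxy; lia.
Qed.

Lemma fh_cover y : exists t, fh t = y \/ (fh t).+1 = y.
Proof.
elim: y => [|y [t [IH|IH]]]; first by exists 0; left.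
  by exists t; right; rewrite IH.
by exists t.+1; rewrite fhS IH; case: (fw _); [left|right]; lia.
Qed.

(** The word has no factor aaa. *)
Lemma fw_no_aaa x : fw x -> fw x.+1 -> ~~ fw x.+2.
Proof.
move=> w0 w1; have x_gt0 := fw_gt0 w0.
have main t : fh t = x -> ~~ fw x.+2.
  move=> Et; have t_gt0 : 0 < t by case: t Et => // Et; move: x_gt0; rewrite -Et.
  have wt : ~~ fw t by rewrite -fw_fh // Et.
  have wt1 := fw_no_bb t_gt0 wt.
  have -> : x.+2 = fh t.+1 by rewrite fhS wt1 Et addn1.
  by rewrite fw_fh // wt1.
have [t [Et|[]]] := fh_cover x.+1; last exact: main.
case: t Et => // t Et; have : ~~ fw t.+1 by rewrite -fw_fh // Et.
move=> wt; apply: (main t); move: Et; rewrite fhS (negbTE wt) addn0; by case.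
Qed.

(** The word has no factor babab: it would come from a factor aaa by the
    substitution. *)
Lemma fw_no_babab x : 0 < x -> ~~ fw x -> ~~ fw x.+2 -> fw x.+4.
Proof.
move=> x_gt0 /(fh_onto x_gt0) [p wp Ep] /fh_onto [] // q wq Eq.
apply/negPn/negP => /fh_onto [] // r wr Er.
have next a b : fw a -> fw b -> fh b = (fh a).+2 -> b = a.+1.
  move=> wa wb E; case: (ltngtP b a.+1) => // H.
    by have := @leq_fh b a H; lia.
  case: b wb E H => // b; rewrite fhS => -> E H.
  by have := @ltn_fh a b H; lia.
have Eqp : q = p.+1 by apply: next => //; lia.
have Erq : r = q.+1 by apply: next => //; lia.
by have := @fw_no_aaa p wp; rewrite -Eqp -Erq wq wr => /(_ isT).
Qed.

(** After aa the word continues with baaba or babaa. Hence [fh] increases by 3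
    over the next two letters and by 8 over the next five, and in both cases the
    last of these letters is an a, so that its image under [fh] carries a b. *)
Lemma fw_aa_fh x : fw x -> fw x.+1 ->
  ~~ fw (fh x.+1 + 3) /\ ~~ fw (fh x.+1 + 8).
Proof.
move=> w0 w1; have w2 := fw_no_aaa w0 w1.
have w3 := @fw_no_bb x.+2 isT w2.
have [e2 e3] := (fhS x.+1, fhS x.+2); rewrite (negbTE w2) w3 in e2 e3.
split.
  have -> : fh x.+1 + 3 = fh x.+3 by lia.
  by rewrite fw_fh // w3.
have [[e4 e5] e6] := (fhS x.+3, fhS x.+4, fhS x.+4.+1).
case w4: (fw x.+4) e4 => e4.
  have w5 : ~~ fw x.+4.+1 by exact: fw_no_aaa.
  have w6 := @fw_no_bb x.+4.+1 isT w5.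
  rewrite (negbTE w5) w6 in e5 e6.
  have -> : fh x.+1 + 8 = fh x.+4.+2 by lia.
  by rewrite fw_fh // w6.
have w5 : fw x.+4.+1 by apply: fw_no_bb; rewrite ?w4.
have w6 : fw x.+4.+2 by apply: (@fw_no_babab x.+2); rewrite ?w4.
rewrite w5 w6 in e5 e6.
have -> : fh x.+1 + 8 = fh x.+4.+2 by lia.
by rewrite fw_fh // w6.
Qed.

(** * Impartial games *)

Section Games.
Variable G : game.

Lemma option_wf p q : is_option G p q -> q.1 + q.2 < p.1 + p.2.
Proof.
case=> i [j [mv Hi Hj ->]] /=.
have : ~~ ((i == 0) && (j == 0)).
  by apply/negP => /andP [/eqP Ei /eqP Ej]; apply: (@move_nonzero G); rewrite -{1}Ei -Ej.
by lia.
Qed.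

Lemma pos_ind (P : nat * nat -> Prop) :
  (forall p, (forall q, is_option G p q -> P q) -> P p) -> forall p, P p.
Proof.
move=> IH p; have [n] := ubnP (p.1 + p.2); elim: n p => // n IHn p Hp.
by apply: IH => q /option_wf Hq; apply: IHn; lia.
Qed.

Lemma Ppos_not_Npos p : Ppos G p -> Npos G p -> False.
Proof.
elim/pos_ind: p => p IH [Hp] [q pq Pq].
by apply: (IH q) => //; exact: Hp.
Qed.

(** If every option of a position of [T] has an option in [T], then the player
    who moves into [T] wins. *)
Lemma Ppos_strategy (T : nat * nat -> Prop) :
  (forall p q, T p -> is_option G p q -> exists2 r, is_option G q r & T r) ->
  forall p, T p -> Ppos G p.
Proof.
move=> HT p; have [n] := ubnP (p.1 + p.2); elim: n p => // n IHn p Hp Tp.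
constructor=> q pq; have [r qr Tr] := HT _ _ Tp pq.
by apply: (Npos_intro qr); apply: IHn => //; move: (option_wf pq) (option_wf qr); lia.
Qed.

(** P and N are invariant under exchanging the coordinates. *)
Lemma pos_sym : (forall i j, move G i j -> move G j i) ->
  forall p, (Ppos G p -> Ppos G (p.2, p.1)) /\ (Npos G p -> Npos G (p.2, p.1)).
Proof.
move=> Gsym; have osym p q : is_option G p q -> is_option G (p.2, p.1) (q.2, q.1).
  by case=> i [j [mv Hi Hj ->]]; exists j, i; split=> //; exact: Gsym.
elim/pos_ind => p IH; split.
  case=> Hp; constructor=> q pq.
  have pq' : is_option G p (q.2, q.1) by move: (osym _ _ pq); case: (p).
  have [_ H] := IH _ pq'; have := H (Hp _ pq'); by case: (q).
case=> q pq Pq; apply: (Npos_intro (osym _ _ pq)).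
by have [H _] := IH _ pq; exact: H.
Qed.

End Games.

(** * P-positions of Wythoff Nim *)

(** [(x, y)] is one of the pairs (A_n, B_n), n > 0. *)
Definition wpair (x y : nat) : Prop := fw x /\ y = fh x.

(** The P-positions of Wythoff Nim, see [Ppos_wythoff]. *)
Definition wP (p : nat * nat) : Prop :=
  [\/ p = (0, 0), wpair p.1 p.2 | wpair p.2 p.1].

Lemma wP_sym x y : wP (x, y) -> wP (y, x).
Proof. by case=> [[-> ->]|H|H]; [exact: Or31|exact: Or33|exact: Or32]. Qed.

Lemma wythoff_sym i j : wythoff_move i j -> wythoff_move j i.
Proof.
case=> x x_gt0 H; exists x => //.
by case: H => [[-> ->]|[-> ->]|[-> ->]]; [exact: Or32|exact: Or31|exact: Or33].
Qed.

Lemma wP_dec p : wP p \/ ~ wP p.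
Proof.
case: (boolP [|| p == (0, 0), fw p.1 && (p.2 == fh p.1) |
              fw p.2 && (p.1 == fh p.2)]) => H; [left|right].
  by case/or3P: H => [/eqP H|/andP [w /eqP E]|/andP [w /eqP E]]; [exact: Or31|exact: Or32|exact: Or33].
move=> H'; case/negP: H; apply/or3P.
case: H' => [->|[w ->]|[w ->]]; rewrite ?w ?eqxx; [exact: Or31|exact: Or32|exact: Or33].
Qed.

(** Each column, and by symmetry each row, contains at most one element of
    [wP]. *)
Lemma wP_unique x y y' : wP (x, y) -> wP (x, y') -> y = y'.
Proof.
have fh_bad z : ~~ (fw z && fw (fh z)).
  by apply/negP => /andP [wz]; rewrite fw_fh ?fw_gt0 // wz.
have fh0 z : fw z -> fh z = 0 -> False by move=> /fh_gt; lia.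
rewrite /wP /wpair /=.
case=> [[-> ->]|[wx ->]|[wy Ex]].
- by case=> [[->]|[]|[wy /esym /(fh0 _ wy)]].
- case=> [[E]|[_ ->]|[wy Ex]] //; first by rewrite E in wx.
  by have := fh_bad y'; rewrite wy -Ex wx.
- case=> [[E]|[wx]|[wy' Ex']].
  + by case: (fh0 _ wy); rewrite -Ex.
  + by have := fh_bad y; rewrite wy -Ex wx.
  + by apply: fh_inj; rewrite -Ex -Ex'.
Qed.

Lemma wP_diag x y d : wP (x, y) -> wP (x + d, y + d) -> d = 0.
Proof.
wlog: x y / x <= y => [H Hxy Hxy'|Hle].
  have [le|/ltnW le] := leqP x y; first exact: (H x y).
  by apply: (H y x) => //; exact: wP_sym.
rewrite /wP /wpair /=; case=> [[-> ->]|[wx Ey]|[wy Ex]]; last by have := fh_gt wy; lia.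
- by case=> [[]|[/fh_gt]|[/fh_gt]]; lia.
- case=> [[]|[wx' Ey']|[/fh_gt]]; try lia.
  have : x = x + d; last by lia.
  by apply: fcount_inj => //; move: Ey Ey'; rewrite /fh; lia.
Qed.

Lemma wP_closed p q : wP p -> is_option wythoff p q -> ~ wP q.
Proof.
case: p => x y Hp [i [j [[d d_gt0 Hij] /= Hi Hj ->]]] Hq.
case: Hij Hi Hj Hq => [[-> ->]|[-> ->]|[-> ->]] Hi Hj; rewrite ?subn0 => Hq.
- by have := wP_unique Hp Hq; lia.
- by have := wP_unique (wP_sym Hp) (wP_sym Hq); lia.
- have := @wP_diag (x - d) (y - d) d Hq; rewrite !subnK // => /(_ Hp); lia.
Qed.

Lemma wP_reply_le x y : x <= y -> ~ wP (x, y) ->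
  exists2 q, is_option wythoff (x, y) q & wP q.
Proof.
move=> Hle nP.
have down z : z < y -> wP (x, z) -> exists2 q, is_option wythoff (x, y) q & wP q.
  move=> Hz Pz; exists (x, z) => //; exists 0, (y - z); split=> //=; last first.
    by rewrite subn0 subKn // ltnW.
    by rewrite leq_subr.
  by exists (y - z); [rewrite subn_gt0|exact: Or31].
have diag z : z < x -> wP (z, y - (x - z)) ->
    exists2 q, is_option wythoff (x, y) q & wP q.
  move=> Hz Pz; exists (z, y - (x - z)) => //; exists (x - z), (x - z); split=> //=.
  - by exists (x - z); [rewrite subn_gt0|exact: Or33].
  - by rewrite leq_subr.
  - by lia.
  - by rewrite subKn // ltnW.
have [x0|x_gt0] := posnP x.
  have [y0|y_gt0] := posnP y; first by case: nP; rewrite x0 y0; exact: Or31.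
  by apply: (down 0) => //; rewrite x0; exact: Or31.
case wx: (fw x); last first.
  have [z wz Ex] := fh_onto x_gt0 (negbT wx).
  apply: (down z); last exact: Or33.
  by have := fh_gt wz; lia.
(* Below h(x) one moves diagonally to the pair (A_d, B_d) with d = y - x, above
   h(x) one lowers y. *)
case: (ltngtP y (fh x)) => Hy; last by case: nP; exact: Or32.
  have [d0|d_gt0] := posnP (y - x).
    by apply: (diag 0) => //; rewrite subn0 d0; exact: Or31.
  have [|z [wz zx] Ez] := @fcount_onto x (y - x) d_gt0; first by move: Hy; rewrite /fh; lia.
  have zx' : z < x.
    by rewrite ltn_neqAle zx andbT; apply/eqP => E; move: Ez Hy; rewrite E /fh; lia.
  by apply: (diag z) => //; apply: Or32; split=> //=; rewrite /fh Ez; lia.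
by apply: (down (fh x)) => //; exact: Or32.
Qed.

Lemma wP_reply p : ~ wP p -> exists2 q, is_option wythoff p q & wP q.
Proof.
case: p => x y nP; have [le|/ltnW le] := leqP x y; first exact: wP_reply_le.
have [|[a b] [i [j [mv Hi Hj [Ea Eb]]]] Pq] := @wP_reply_le y x le.
  by move=> /wP_sym.
exists (b, a); last exact: wP_sym.
by exists j, i; split=> //; [exact: wythoff_sym|rewrite Ea Eb].
Qed.

Lemma Ppos_wythoff p : Ppos wythoff p <-> wP p.
Proof.
have suff_ : forall p, wP p -> Ppos wythoff p.
  apply: Ppos_strategy => {}p q Pp pq; apply: wP_reply; exact: wP_closed pq.
split; last exact: suff_.
move=> Pp; case: (wP_dec p) => // /wP_reply [q pq Pq].
by case: (Ppos_not_Npos Pp); apply: (Npos_intro pq); exact: suff_.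
Qed.

(** * Basic positions of the dual game *)

Notation Pstar x y := (Ppos (star wythoff) (x, y)).
Notation Nstar x y := (Npos (star wythoff) (x, y)).

Lemma star_wythoffE i j :
  move (star wythoff) i j <-> wpair i j \/ wpair j i.
Proof.
have nz x y : wpair x y -> 0 < x /\ 0 < y.
  by case=> wx ->; have := fw_gt0 wx; have := fh_gt wx; lia.
split=> [[/Ppos_wythoff [//|H|H] _]|H]; [by left|by right|].
split; last by case=> Ei Ej; case: H => /nz; lia.
by apply/Ppos_wythoff; case: H => H; [exact: Or32|exact: Or33].
Qed.

Lemma Pstar_sym x y : Pstar x y -> Pstar y x.
Proof.
by case: (@pos_sym (star wythoff) _ (x, y)) => // i j /star_wythoffE H;
  apply/star_wythoffE; case: H; [right|left].
Qed.

Lemma Nstar_sym x y : Nstar x y -> Nstar y x.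
Proof.
by case: (@pos_sym (star wythoff) _ (x, y)) => // i j /star_wythoffE H;
  apply/star_wythoffE; case: H; [right|left].
Qed.

(** To prove a position P it suffices to refute the two kinds of moves. *)
Lemma Pstar_intro X Y :
  (forall x, fw x -> x <= X -> fh x <= Y -> Nstar (X - x) (Y - fh x)) ->
  (forall x, fw x -> fh x <= X -> x <= Y -> Nstar (X - fh x) (Y - x)) ->
  Pstar X Y.
Proof.
move=> H1 H2; constructor=> q [i [j [/star_wythoffE H /= Hi Hj ->]]].
by case: H Hi Hj => [[w ->]|[w ->]] Hi Hj; [exact: H1|exact: H2].
Qed.

Lemma Nstar_move x u v : fw x -> x <= u -> fh x <= v ->
  Pstar (u - x) (v - fh x) -> Nstar u v.
Proof.
move=> wx Hu Hv; apply: Npos_intro; exists x, (fh x); split=> //.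
by apply/star_wythoffE; left.
Qed.

(** Positions on an axis have no options. *)
Lemma Pstar_axis x : Pstar x 0.
Proof.
by apply: Pstar_intro => y wy H1 H2; have := fw_gt0 wy; have := fh_gt wy; lia.
Qed.

(** The move [(u, fh u)] leads to an axis. *)
Lemma Nstar_far u v : fw u -> fh u <= v -> Nstar u v.
Proof.
move=> wu Hv; apply: (Nstar_move wu) => //; rewrite subnn.
exact/Pstar_sym/Pstar_axis.
Qed.

(** If a coordinate is not a lower Wythoff number, then some move leads to an
    axis. *)
Lemma Nstar_off u v : 0 < u -> 0 < v -> ~~ (fw u && fw v) -> Nstar u v.
Proof.
wlog: u v / u <= v => [H u0 v0 nw|Hle u0 v0].
  have [le|/ltnW le] := leqP u v; first exact: H.
  by apply/Nstar_sym/H; rewrite 1?andbC.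
case wu: (fw u) => /= nw; last first.
  have [x wx Eu] := fh_onto u0 (negbT wu).
  have xu : x < u by rewrite Eu; exact: fh_gt.
  apply/Nstar_sym/(Nstar_move wx); try by lia.
  by rewrite -Eu subnn; exact: Pstar_axis.
have [x wx Ev] := fh_onto v0 nw.
have [xu|ux] := leqP x u.
  by apply: (Nstar_move wx) => //; rewrite ?Ev // subnn; exact: Pstar_axis.
by apply: Nstar_far => //; rewrite Ev leq_fh // ltnW.
Qed.

(** The pairs (A_n, B_n) with A_n < 15. *)
Definition wmoves := [:: (1, 2); (3, 5); (4, 7); (6, 10); (8, 13); (9, 15);
                         (11, 18); (12, 20); (14, 23)].

Lemma wmovesE : [seq (x, fh x) | x <- iota 0 15 & fw x] = wmoves.
Proof. by vm_compute. Qed.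

Lemma mem_wmoves x : fw x -> x < 15 -> (x, fh x) \in wmoves.
Proof.
by move=> wx Hx; rewrite -wmovesE map_f // mem_filter wx mem_iota.
Qed.

Lemma wmoves_wpair z : z \in wmoves -> wpair z.1 z.2.
Proof. by rewrite -wmovesE => /mapP [x]; rewrite mem_filter => /andP [wx _] ->. Qed.

(** The fixed P-positions that serve as targets of replies, with their
    transposes. *)
Definition smallP := [:: (1, 1); (3, 3); (3, 4); (4, 3); (6, 6); (8, 9); (9, 8);
                         (11, 11); (11, 12); (12, 11); (14, 14)].

(** Together with the axes, they are closed under replies. *)
Definition smallT (p : nat * nat) : bool := [|| p.1 == 0, p.2 == 0 | p \in smallP].

(** The options of a position with coordinates below 15. *)
Definition opts (p : nat * nat) : seq (nat * nat) :=
  [seq (p.1 - z.1, p.2 - z.2) | z <- wmoves & (z.1 <= p.1) && (z.2 <= p.2)] ++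
  [seq (p.1 - z.2, p.2 - z.1) | z <- wmoves & (z.2 <= p.1) && (z.1 <= p.2)].

Lemma mem_opts p q : p.1 < 15 -> p.2 < 15 ->
  is_option (star wythoff) p q -> q \in opts p.
Proof.
move=> p1 p2 [i [j [/star_wythoffE H /= Hi Hj ->]]]; rewrite mem_cat; apply/orP.
case: H Hi Hj => -[w ->] Hi Hj; [left|right].
  apply/mapP; exists (i, fh i) => //; rewrite mem_filter Hi Hj.
  by rewrite mem_wmoves //; exact: leq_ltn_trans p1.
apply/mapP; exists (j, fh j) => //; rewrite mem_filter Hi Hj.
by rewrite mem_wmoves //; exact: leq_ltn_trans p2.
Qed.

Lemma opts_option p q : q \in opts p -> is_option (star wythoff) p q.
Proof.
rewrite mem_cat => /orP [] /mapP [z]; rewrite mem_filter => /andP [/andP [H1 H2]];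
  move=> /wmoves_wpair w ->.
  by exists z.1, z.2; split=> //; apply/star_wythoffE; left.
by exists z.2, z.1; split=> //; apply/star_wythoffE; right.
Qed.

Lemma smallP_Ppos p : p \in smallP -> Ppos (star wythoff) p.
Proof.
move=> Hp; apply: (@Ppos_strategy _ smallT); last by rewrite /smallT Hp !orbT.
move=> {Hp}p q /or3P [/eqP E|/eqP E|Hp] pq.
- case: pq => i [j [/star_wythoffE H Hi Hj _]]; rewrite {}E in Hi.
  by case: H => -[w E]; have := fw_gt0 w; have := fh_gt w; lia.
- case: pq => i [j [/star_wythoffE H Hi Hj _]]; rewrite {}E in Hj.
  by case: H => -[w E]; have := fw_gt0 w; have := fh_gt w; lia.
have /allP check : all (fun p => [&& p.1 < 15, p.2 < 15 &
    all (fun q => has smallT (opts q)) (opts p)]) smallP by vm_compute.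
have /and3P [p1 p2 /allP H] := check p Hp.
have /hasP [r Hr Tr] := H q (mem_opts p1 p2 pq).
by exists r => //; exact: opts_option.
Qed.

(** The first eight pairs (A_n, B_n). *)
Lemma early_letter x : fw x -> fcount x <= 8 ->
  x = 1 /\ fh x = 2 \/ x = 3 /\ fh x = 5 \/ x = 4 /\ fh x = 7 \/
  x = 6 /\ fh x = 10 \/ x = 8 /\ fh x = 13 \/ x = 9 /\ fh x = 15 \/
  x = 11 /\ fh x = 18 \/ x = 12 /\ fh x = 20.
Proof.
move=> wx Hc; have E14 : fcount 14 = 9 by vm_compute.
have Hx : x < 14 by rewrite ltnNge; apply/negP => /leq_fcount; lia.
have := mem_wmoves wx (ltnW Hx); rewrite !inE !xpair_eqE => {wx Hc E14}.
do 8 (case/orP => [/andP [/eqP E1 /eqP E2]|]; first by tauto).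
by case/andP => /eqP E1; rewrite E1 in Hx.
Qed.

(** * Positions near a pair of Fibonacci numbers *)

Section Near.
(* With n = k + 1, these are F_{2n-2}, F_{2n-1} and F_{2n}. *)
Variable k : nat.
Hypothesis k_gt0 : 0 < k.
Local Notation m := (fib k.*2).
Local Notation F := (fib k.*2.+1).
Local Notation G := (fib k.*2.+2).

Lemma fibG : G = F + m. Proof. by []. Qed.

Lemma ltn_mF : m < F.
Proof.
case: k k_gt0 => // k' _; rewrite doubleS (fibS k'.*2.+1).
by have := fib_gt0 k'.*2.+1; lia.
Qed.

Lemma m_gt1 : 1 < m.
Proof. by apply: leq_trans (fib_ge _); rewrite -addnn; lia. Qed.

Lemma fw_F : fw F. Proof. by rewrite fw_fib odd_double. Qed.

Lemma fh_F : fh F = G. Proof. exact: fh_fib. Qed.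

Lemma fcount_F : fcount F = m. Proof. exact: fcount_fib. Qed.

Lemma fw_Fpred : fw (F - 1) = false.
Proof. by case: k k_gt0 => // k' _; rewrite doubleS subn1 fw_fib_pred odd_double. Qed.

Lemma fw_Gpred : fw (G - 1).
Proof.
by case: k k_gt0 => // k' _; rewrite doubleS subn1 fw_fib_pred oddS odd_double.
Qed.

Lemma fw_Fsub i : 0 < i -> i + 1 < F -> fw (F - 1 - i) = fw i.
Proof. exact: fw_pal. Qed.

Lemma fw_Gsub i : 0 < i -> i + 1 < G -> fw (G - 1 - i) = fw i.
Proof. exact: fw_pal. Qed.

Lemma fw_Fadd i : 0 < i -> i <= m -> fw (F + i) = fw i.
Proof. by case: k k_gt0 => // k' _; rewrite doubleS; exact: fw_shift. Qed.

Lemma fcount_ltF x : x < F -> fcount x < m.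
Proof. by rewrite -fcount_F => H; apply: fcount_lt fw_F. Qed.

Lemma fh_Fsub_pred i : i + 1 < F -> fh (F - 1 - i.+1) + fh i + 3 = G.
Proof.
have := fhS (F - 1); have := fhS (F - 2).
have -> : (F - 2).+1 = F - 1 by have := ltn_mF; have := m_gt1; lia.
have -> : (F - 1).+1 = F by have := ltn_mF; lia.
rewrite fh_F fw_F fw_Fpred => E1 E2.
elim: i => [|i IH] Hi.
  have -> : F - 1 - 1 = F - 2 by lia.
  by have E0 : fh 0 = 0 by []; lia.
have := IH; rewrite fhS.
have := fhS (F - 1 - i.+2).
have -> : (F - 1 - i.+2).+1 = F - 1 - i.+1 by lia.
by rewrite fw_Fsub //; lia.
Qed.

(** Reflection in (F - 1, G - 1) maps moves to moves: if [(i, fh i)] is one, then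
    so is (F - 1 - i, G - 1 - h(i)). *)
Lemma fh_Fsub i : fw i -> i + 1 < F -> fh (F - 1 - i) + fh i + 1 = G.
Proof.
case: i => // i wi Hi; have := @fh_Fsub_pred i; rewrite fhS wi; lia.
Qed.

(** From (u, v), the move (F - 1 - i, G - 1 - h(i)) leads to (a, b). *)
Lemma Nstar_reply i a b u v : fw i -> i + 1 < F -> u + i + 1 = a + F ->
  v + fh i + 1 = b + G -> Pstar a b -> Nstar u v.
Proof.
move=> wi Hi Eu Ev; have Eh := fh_Fsub wi Hi.
have i_gt0 := fw_gt0 wi.
have wj : fw (F - 1 - i) by rewrite fw_Fsub.
move=> Pab; apply: (Nstar_move wj); try by lia.
have -> : u - (F - 1 - i) = a by lia.
by have -> : v - fh (F - 1 - i) = b by lia.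
Qed.

Lemma Pstar_diag : Pstar (G - 1) (G - 1).
Proof.
have H x : fw x -> fh x <= G - 1 -> Nstar (G - 1 - x) (G - 1 - fh x).
  move=> wx Hx; have xh := fh_gt wx; have wh : fw (fh x) = false.
    by rewrite fw_fh ?fw_gt0 // wx.
  have Nh : fh x != G - 1 by apply: contraFneq wh => ->; exact: fw_Gpred.
  by apply: Nstar_off; try lia; rewrite [fw (_ - fh x)]fw_Gsub ?wh ?andbF //; lia.
by apply: Pstar_intro => x wx *; [exact: H|apply/Nstar_sym/H].
Qed.

(** Positions with second coordinate G - 1: only the options reached by
    [(fh x, x)] with [fcount x < c] have to be examined. *)
Lemma Pstar_row c : (c == 0) || fw c -> c < m ->
  (forall x, fw x -> fcount x < c -> fh x <= F + c ->
     Nstar (F + c - fh x) (G - 1 - x)) ->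
  Pstar (F + c) (G - 1).
Proof.
(* Subtracting (x, h(x)) makes the second coordinate a b. Subtracting (h(x), x)
   with c(x) >= c gives (u, v) with u < F, so c(u) <= m - 1 <= v - u. *)
move=> wc cm H; have EG := fibG.
have wX : fw (F + c).
  case/orP: wc => [/eqP ->|wc]; first by rewrite addn0 fw_F.
  by rewrite fw_Fadd ?fw_gt0 // ltnW.
apply: Pstar_intro => x wx H1 H2; have xh := fh_gt wx; have x0 := fw_gt0 wx;
  have wh : fw (fh x) = false by rewrite fw_fh // wx.
- have Nh : fh x != G - 1 by apply: contraFneq wh => ->; exact: fw_Gpred.
  have Nx : x < F + c.
    rewrite ltnNge; apply/negP => Hx.
    by have := @leq_fh F x; rewrite fh_F; lia.
  by apply: Nstar_off; try lia; rewrite [fw (_ - fh x)]fw_Gsub ?wh ?andbF //; lia.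
- have [xc|cx] := ltnP (fcount x) c; first exact: H.
  have Nh : fh x != F + c by apply: contraFneq wh => ->.
  have Eh : fh x = x + fcount x by [].
  case wu: (fw (F + c - fh x)); last by apply: Nstar_off; rewrite ?wu //; lia.
  apply: Nstar_far => //; have := @fcount_ltF (F + c - fh x).
  by have : fh (F + c - fh x) = F + c - fh x + fcount (F + c - fh x) by []; lia.
Qed.

(** A lower bound on F_{2n-2} excludes small n. *)
Lemma mF_cases : m = 2 /\ F = 3 \/ m = 5 /\ F = 8 \/ 13 <= m /\ 21 <= F.
Proof.
case: k k_gt0 => // -[|[|j]] _; [by left|by right; left|right; right].
have e6 : fib 6 = 13 by []. have e7 : fib 7 = 21 by [].
by rewrite -e6 -e7 !leq_fib // !doubleS.
Qed.

(** Positions with first coordinate F, lying [d] below (F, G - 1): only the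
    options reached by [(fh x, x)] with [fcount x < d] have to be examined. *)
Lemma Pstar_col d : 0 < d -> fw d -> d < m ->
  (forall x, fw x -> fw x.+1 -> ~~ fw (fh x.+1 + d)) ->
  (forall x, fw x -> fcount x < d -> fh x <= F -> x <= G - 1 - d ->
     Nstar (F - fh x) (G - 1 - d - x)) ->
  Pstar F (G - 1 - d).
Proof.
move=> d0 wd dm Hloc Hsmall; have EG := fibG; have mF := ltn_mF.
apply: Pstar_intro => x wx H1 H2; have xh := fh_gt wx; have x0 := fw_gt0 wx;
  have wh : fw (fh x) = false by rewrite fw_fh // wx.
- have Nh : fh x != G - 1 - d.
    by apply: contraFneq wh => ->; rewrite fw_Gsub //; lia.
  have Nx : x != F by apply/eqP => E; move: H2; rewrite E fh_F; lia.
  (* By the two reflections, both coordinates of the option can be lower Wythoff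
     numbers only if x - 1 is one and h(x) + d is one. *)
  apply: Nstar_off; try lia; apply/negP.
  case: x wx H1 H2 xh x0 wh Nh Nx => // -[|x] wx H1 H2 xh x0 wh Nh Nx.
    by rewrite fw_Fpred.
  have -> : F - x.+2 = F - 1 - x.+1 by lia.
  have -> : G - 1 - d - fh x.+2 = G - 1 - (fh x.+2 + d) by lia.
  rewrite fw_Fsub; [|lia|lia]; rewrite fw_Gsub; [|lia|lia].
  by case/andP => wx1; apply/negP; exact: Hloc.
- have [xd|dx] := ltnP (fcount x) d; first exact: Hsmall.
  have Nh : fh x != F by apply: contraFneq wh => ->; exact: fw_F.
  have Eh : fh x = x + fcount x by [].
  case wu: (fw (F - fh x)); last by apply: Nstar_off; rewrite ?wu //; lia.
  apply: Nstar_far => //; have := @fcount_ltF (F - fh x).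
  by have : fh (F - fh x) = F - fh x + fcount (F - fh x) by []; lia.
Qed.

(** The move (F - 1 - i, G - 1 - h(i)) leads from (F - 1 - i, v) to an axis. *)
Lemma Nstar_Fsub i u v : fw i -> i + 1 < F -> u + i + 1 = F ->
  G <= v + fh i + 1 -> Nstar u v.
Proof.
move=> wi Hi Eu Ev; have Eh := fh_Fsub wi Hi.
have -> : u = F - 1 - i by lia.
by apply: Nstar_far; [rewrite fw_Fsub // fw_gt0|lia].
Qed.

Lemma Nstar_off_l u v : ~~ fw u -> 0 < u -> 0 < v -> Nstar u v.
Proof. by move=> nu u0 v0; apply: Nstar_off => //; rewrite negb_and nu. Qed.

Lemma Pstar_row0 : Pstar F (G - 1).
Proof.
have := @Pstar_row 0 isT; rewrite addn0; apply=> //.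
by have := m_gt1; lia.
Qed.

Lemma Pstar_row1 : 1 < m -> Pstar (F + 1) (G - 1).
Proof.
move=> Hm; apply: Pstar_row => // x wx; have := fcount_gt0 wx; lia.
Qed.

Lemma fw4 : fw 4. Proof. by []. Qed.
Lemma fh4 : fh 4 = 7. Proof. by []. Qed.
Lemma fw9 : fw 9. Proof. by vm_compute. Qed.
Lemma fh9 : fh 9 = 15. Proof. by vm_compute. Qed.
Lemma fw12 : fw 12. Proof. by vm_compute. Qed.
Lemma fh12 : fh 12 = 20. Proof. by vm_compute. Qed.

Lemma Pstar_row3 : 3 < m -> Pstar (F + 3) (G - 1).
Proof.
move=> Hm; have EG := fibG; have mc := mF_cases.
apply: Pstar_row => // x wx xc Hx.
have Eh : fh x = x + fcount x by [].
have [] := early_letter wx; first by lia.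
  case=> Ex E; rewrite E Ex.
  by apply: (@Nstar_reply 4 6 6); rewrite ?fw4 ?fh4 //; [lia..|exact: smallP_Ppos].
case=> [[Ex E]|H]; last by lia.
rewrite E Ex.
by apply: (@Nstar_reply 4 3 4); rewrite ?fw4 ?fh4 //; [lia..|exact: smallP_Ppos].
Qed.

Lemma Pstar_row4 : 4 < m -> Pstar (F + 4) (G - 1).
Proof.
move=> Hm; have EG := fibG; have mc := mF_cases.
apply: Pstar_row => // x wx xc Hx.
have Eh : fh x = x + fcount x by [].
have [] := early_letter wx; first by lia.
  case=> Ex E; rewrite E Ex.
  have -> : F + 4 - 2 = F + 2 by lia.
  by apply: Nstar_off_l; rewrite ?fw_Fadd //; lia.
case=> [[Ex E]|].
  rewrite E Ex.
  have -> : F + 4 - 5 = F - 1 by lia.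
  by apply: Nstar_off_l; rewrite ?fw_Fpred //; lia.
case=> [[Ex E]|]; last by lia.
rewrite E Ex.
have -> : F + 4 - 7 = F - 1 - 2 by lia.
by apply: Nstar_off_l; rewrite ?fw_Fsub //; lia.
Qed.

Lemma Pstar_row6 : 6 < m -> Pstar (F + 6) (G - 1).
Proof.
move=> Hm; have EG := fibG; have mc := mF_cases.
apply: Pstar_row => // x wx xc Hx.
have Eh : fh x = x + fcount x by [].
have [] := early_letter wx; first by lia.
  case=> Ex E; rewrite E Ex.
  by apply: (@Nstar_reply 9 14 14); rewrite ?fw9 ?fh9 //; [lia..|exact: smallP_Ppos].
case=> [[Ex E]|].
  rewrite E Ex.
  by apply: (@Nstar_reply 9 11 12); rewrite ?fw9 ?fh9 //; [lia..|exact: smallP_Ppos].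
case=> [[Ex E]|].
  rewrite E Ex.
  have -> : F + 6 - 7 = F - 1 by lia.
  by apply: Nstar_off_l; rewrite ?fw_Fpred //; lia.
case=> [[Ex E]|].
  rewrite E Ex.
  by apply: (@Nstar_reply 4 1 1); rewrite ?fw4 ?fh4 //; [lia..|exact: smallP_Ppos].
case=> [[Ex E]|]; last by lia.
rewrite E Ex.
have [w6 h6] : fw 6 /\ fh 6 = 10 by vm_compute.
by apply: (@Nstar_Fsub 6); rewrite ?h6 //; lia.
Qed.

Lemma Pstar_col3 : 3 < m -> Pstar F (G - 4).
Proof.
move=> Hm; have EG := fibG; have mc := mF_cases.
have -> : G - 4 = G - 1 - 3 by lia.
apply: Pstar_col => // [x w0 w1|x wx xc Hx _]; first by case: (fw_aa_fh w0 w1).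
have Eh : fh x = x + fcount x by [].
have [] := early_letter wx; first by lia.
  case=> Ex E; rewrite E Ex.
  by apply: (@Nstar_reply 4 3 3); rewrite ?fw4 ?fh4 //; [lia..|exact: smallP_Ppos].
case=> [[Ex E]|]; last by lia.
rewrite E Ex.
by apply: (@Nstar_Fsub 4); rewrite ?fw4 ?fh4 //; lia.
Qed.

Lemma Pstar_col8 : 8 < m -> Pstar F (G - 9).
Proof.
move=> Hm; have EG := fibG; have mc := mF_cases.
have -> : G - 9 = G - 1 - 8 by lia.
apply: Pstar_col => // [x w0 w1|x wx xc Hx _]; first by case: (fw_aa_fh w0 w1).
have Eh : fh x = x + fcount x by [].
have [] := early_letter wx; first by lia.
  case=> Ex E; rewrite E Ex.
  by apply: (@Nstar_reply 12 11 11); rewrite ?fw12 ?fh12 //; [lia..|exact: smallP_Ppos].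
case=> [[Ex E]|].
  rewrite E Ex.
  by apply: (@Nstar_reply 12 8 9); rewrite ?fw12 ?fh12 //; [lia..|exact: smallP_Ppos].
case=> [[Ex E]|].
  rewrite E Ex.
  by apply: (@Nstar_reply 9 3 3); rewrite ?fw9 ?fh9 //; [lia..|exact: smallP_Ppos].
case=> [[Ex E]|].
  rewrite E Ex.
  by apply: (@Nstar_Fsub 9); rewrite ?fw9 ?fh9 //; lia.
case=> [[Ex E]|].
  rewrite E Ex.
  by apply: (@Nstar_Fsub 12); rewrite ?fw12 ?fh12 //; lia.
case=> [[Ex E]|].
  rewrite E Ex.
  have [w14 h14] : fw 14 /\ fh 14 = 23 by vm_compute.
  by apply: (@Nstar_Fsub 14); rewrite ?h14 //; lia.
case=> [[Ex E]|]; last by lia.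
rewrite E Ex.
have [w17 h17] : fw 17 /\ fh 17 = 28 by vm_compute.
by apply: (@Nstar_Fsub 17); rewrite ?h17 //; lia.
Qed.

End Near.

(* Subtraction on nat is truncated, so [0 < fib (2 * n) - k] says exactly that
   the integer F_{2n} - k is positive, and then the two subtractions agree.
   The pairs are read with the smaller coordinate first ([x <= y]). *)
Theorem theorem2 (n : nat) (hn : 0 < n) (x y : nat)
    (hxy : (x, y) \in
       [:: (fib (2 * n) - 1, fib (2 * n) - 1);
           (fib (2 * n - 1), fib (2 * n) - 1);
           (fib (2 * n - 1), fib (2 * n) - 4);
           (fib (2 * n - 1), fib (2 * n) - 9);
           (fib (2 * n - 1) + 1, fib (2 * n) - 1);
           (fib (2 * n - 1) + 3, fib (2 * n) - 1);
           (fib (2 * n - 1) + 4, fib (2 * n) - 1);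
           (fib (2 * n - 1) + 6, fib (2 * n) - 1)])
    (hx : 0 < x) (hy : 0 < y) (hle : x <= y) :
  Ppos (star wythoff) (x, y) /\ Ppos (star wythoff) (y, x).
Proof.
suff H : Pstar x y by split; last exact: Pstar_sym.
case: n hn hxy => // k _; have -> : 2 * k.+1 - 1 = k.*2.+1 by lia.
have -> : 2 * k.+1 = k.*2.+2 by lia.
(* For n = 1 the constraints leave only (1, 1). *)
have [->|k_gt0] := posnP k.
  move: hx hy hle; rewrite !inE !xpair_eqE /= => hx hy hle H.
  have [-> ->] : x = 1 /\ y = 1 by lia.
  exact: smallP_Ppos.
(* In the remaining cases x <= y says that F_{2n-2} exceeds the offset of the
   position from (F_{2n-1}, F_{2n} - 1). *)
have EG := fibG k.
rewrite !inE !xpair_eqE.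
case/orP => [/andP [/eqP Ex /eqP Ey]|].
  by rewrite Ex Ey; exact: Pstar_diag.
case/orP => [/andP [/eqP Ex /eqP Ey]|].
  by rewrite Ex Ey; exact: Pstar_row0.
case/orP => [/andP [/eqP Ex /eqP Ey]|].
  by rewrite Ex Ey; apply: Pstar_col3 => //; lia.
case/orP => [/andP [/eqP Ex /eqP Ey]|].
  by rewrite Ex Ey; apply: Pstar_col8 => //; lia.
case/orP => [/andP [/eqP Ex /eqP Ey]|].
  by rewrite Ex Ey; apply: Pstar_row1 => //; lia.
case/orP => [/andP [/eqP Ex /eqP Ey]|].
  by rewrite Ex Ey; apply: Pstar_row3 => //; lia.
case/orP => [/andP [/eqP Ex /eqP Ey]|].
  by rewrite Ex Ey; apply: Pstar_row4 => //; lia.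
case/andP => /eqP Ex /eqP Ey.
by rewrite Ex Ey; apply: Pstar_row6 => //; lia.
Qed.
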